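(* Let $n=2p^s$, where $p$ is an odd prime and $s\in\mathbb{N}$. Let $m\in\mathbb{N}\cup\{0\}$ and integers $0=k_0<k_1<\cdots<k_m<s$, and let $S=\{p^{k_0},\ldots,p^{k_m},n-p^{k_0},\ldots,n-p^{k_m}\}\subseteq\mathbb{Z}_n$. If $\gcd(p,m+1)=1$, then the complement of the circulant graph $\mathrm{Cay}(\mathbb{Z}_n,S)$ exhibits PGFR.
   Context: The circulant graph $\mathrm{Cay}(\mathbb{Z}_n,S)$ (with $S\subseteq\mathbb{Z}_n\setminus\{0\}$, $S=-S$) has vertex set $\mathbb{Z}_n$, two distinct vertices $a,b$ being adjacent iff $b-a\in S$; its complement is $\mathrm{Cay}(\mathbb{Z}_n,\mathbb{Z}_n\setminus(S\cup\{0\}))$. For a graph $\Gamma$ with adjacency matrix $A$, the transition matrix is $H(t)=\exp(-\mathbf{i}tA)$, $t\in\mathbb{R}$, and $\mathbf{e}_v$ is the standard basis vector of vertex $v$. $\Gamma$ exhibits pretty good fractional revival (PGFR) between distinct vertices $a$ and $b$ if there is a sequence of real numbers $\{t_k\}$ with $\lim_{k\to\infty}H(t_k)\mathbf{e}_a=\alpha\mathbf{e}_a+\beta\mathbf{e}_b$ for some $\alpha,\beta\in\mathbb{C}$ with $\beta\neq0$ and $|\alpha|^2+|\beta|^2=1$; $\Gamma$ exhibits PGFR if it does so between some pair of distinct vertices. *)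

(* Defs.v *)
From HB Require Import structures.
From mathcomp Require Import all_boot all_order all_algebra.
From mathcomp Require Import all_classical all_reals all_analysis.
From mathcomp Require Import complex.

Set Implicit Arguments.
Unset Strict Implicit.
Unset Printing Implicit Defensive.

Import Order.TTheory GRing.Theory Num.Theory.
Import numFieldNormedType.Exports.

Local Open Scope classical_set_scope.
Local Open Scope complex_scope.
Local Open Scope ring_scope.

(* Graphs on 'I_n are boolean relations, so that adjacency matrices are
   indexed directly by vertices; note that 'Z_n is 'I_n when 1 < n. *)

Definition circulant (n : nat) (S : {set 'Z_n}) : rel 'Z_n :=
  fun a b => (a != b) && (b - a \in S).

Definition complement (n : nat) (e : rel 'I_n) : rel 'I_n :=
  fun a b => (a != b) && ~~ e a b.

Lemma complement_circulant (n : nat) (S : {set 'Z_n}) :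
  complement (circulant S) =2 circulant (~: (0 |: S)).
Proof.
move=> a b; rewrite /complement /circulant.
by case: eqVneq => [//|ab] /=; rewrite !inE subr_eq0 eq_sym (negPf ab).
Qed.

(* The topology on matrices is the product (sup norm) topology. *)
Definition expmx (K : numFieldType) (n : nat) (M : 'M[K]_n) : 'M[K]_n :=
  limn (series (fun k => k`!%:R^-1 *: M ^+ k)).

Section Revival.
Variables (R : realType) (n : nat) (e : rel 'I_n).

Definition adjacency_mx : 'M[R[i]]_n := \matrix_(a, b) (e a b)%:R.

Definition transition_mx (t : R) : 'M[R[i]]_n :=
  expmx (- ('i%C * t%:C) *: adjacency_mx).

Definition pgfr_between (a b : 'I_n) : Prop :=
  a != b /\
  exists (t : nat -> R) (alpha beta : R[i]),
    [/\ beta != 0,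
        `|alpha| ^+ 2 + `|beta| ^+ 2 = 1 &
        (fun k => transition_mx (t k) *m delta_mx a 0) @ \oo -->
          (alpha *: delta_mx a 0 + beta *: delta_mx b 0
             : 'cV[R[i] : numFieldType]_n)].

Definition pgfr : Prop := exists a b : 'I_n, pgfr_between a b.

End Revival.

(* Main.v *)
(* Write c_j = 1 + 2(m+1)(-1)^j and e(x) = exp(2 pi i x).  The antipodal vertices 0 and
   n/2 admit PGFR as soon as some times t make exp(-i t mu_j) tend to a limit that
   depends only on the parity of j, with two different limits; here mu_j = n [j = 0]
   - 1 - lam_j is the j-th eigenvalue of the complement and lam_j that of Cay(Z_n, S).
   At t = 2 pi T / p with T a natural number, exp(-i t mu_j) = xi_j ^ T where
   xi_j = e((1 + lam_j) / p), because p divides n, and the wanted limit is e(c_j / p):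
   the two values differ because p does not divide 4(m+1).

   By Kronecker's approximation theorem such T exist provided each multiplicative
   relation between the xi_j also holds between the e(c_j / p), that is, provided
   sum_j l_j (1 + lam_j) in pZ implies p | sum_j l_j c_j for integers l_j.  This holds
   because lam_j is a sum of 2(m+1) odd powers of w ^ j, where w is a primitive n-th
   root of unity, and w is congruent to -1 modulo the prime above p. *)

Require Import Defs.
From HB Require Import structures.
From mathcomp Require Import all_boot all_order all_algebra.
From mathcomp Require Import all_classical all_reals all_analysis.
From mathcomp Require Import complex ring lra zify.

Set Implicit Arguments.
Unset Strict Implicit.
Unset Printing Implicit Defensive.

Import Order.TTheory GRing.Theory Num.Theory.
Import numFieldNormedType.Exports.
Local Open Scope ring_scope.

(** * Reduction of cyclotomic relations modulo p *)

(** Monic polynomials keep their size under [f], so the two Sylvester matrices have the same shape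
    and correspond entry by entry. *)
Lemma map_resultant_monic (A B : nzRingType) (f : {rmorphism A -> B}) (p q : {poly A}) :
  p \is monic -> q \is monic ->
  f (resultant p q) = resultant (map_poly f p) (map_poly f q).
Proof.
move=> /monicP pm /monicP qm.
rewrite /resultant /Sylvester_mx !size_map_poly_id0 ?pm ?qm ?rmorph1 ?oner_eq0 //.
rewrite -det_map_mx /= map_col_mx; congr (\det (col_mx _ _));
  by apply: map_lin1_mx => v; rewrite map_poly_rV rmorphM /= map_rVpoly.
Qed.

(** Q and X^N + 1, with N = p^s, share the root [w], so their resultant is 0. Modulo p this gives Q
    a common factor with (X + 1)^N, hence the root -1. *)
Lemma dvdz_eval_opp1 (F : numFieldType) (p s : nat) (w : F) (Q : {poly int}) :
  prime p -> w ^+ (p ^ s) = -1 -> root (map_poly intr Q) w -> (p %| Q.[-1])%Z.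
Proof.
move=> p_pr wN Qw; set N := (p ^ s)%N.
have N_gt0 : (0 < N)%N by rewrite expn_gt0 prime_gt0.
(* Adding a multiple of D makes Q monic, so that resultants commute with reduction
   modulo p, where D becomes (X + 1)^N. *)
pose D : {poly int} := 'X^N + 1; pose Q1 := Q + 'X^(size Q) * D.
have D_monic : D \is monic by rewrite /D -polyC1 monicXnaddC.
have Q1_monic : Q1 \is monic.
  have XD : 'X^(size Q) * D \is monic by rewrite monicMl ?monicXn.
  rewrite monicE /Q1 addrC lead_coefDl ?(eqP XD) //.
  by rewrite size_monicM ?monicXn ?monic_neq0 // size_polyXn /D -polyC1 size_XnaddC //
             addnS ltnS leq_addr.
have Dw : root (map_poly intr D : {poly F}) w.
  by rewrite rmorphD rmorph1 /= map_polyXn /root !hornerE wN addNr.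
have Q1w : root (map_poly intr Q1 : {poly F}) w.
  by rewrite rmorphD rmorphM /= rootE hornerD hornerM (rootP Qw) (rootP Dw) mulr0 addr0.
have r0 : resultant Q1 D = 0.
  apply/eqP; rewrite -(intr_eq0 F) map_resultant_monic // resultant_eq0.
  have <- : size ('X - w%:P) = 2%N by rewrite size_XsubC.
  rewrite dvdp_leq ?dvdp_gcd ?dvdp_XsubCl ?Dw ?Q1w //.
  by rewrite gcdp_eq0 negb_and monic_neq0 ?monic_map.
have pchar := pchar_Fp p_pr.
rewrite (dvdz_pcharf pchar) -(rmorphN1 intr) -(horner_map intr).
have := congr1 (intr : int -> 'F_p) r0.
rewrite map_resultant_monic // => /eqP; rewrite resultant_eq0.
have DE : map_poly intr D = ('X - (-1)%:P) ^+ N :> {poly 'F_p}.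
  rewrite rmorphD rmorph1 /= map_polyXn polyCN opprK exprDn_pchar ?polyC1 ?expr1n //.
  by rewrite pnatX pnatE // (pchar_poly _ p) pchar.
have D0 : (map_poly intr D : {poly 'F_p}).[-1] = 0.
  by rewrite DE hornerE hornerXsubC subrr expr0n eqn0Ngt N_gt0.
rewrite DE ltnNge; apply: contraNT => Qn0.
suff /eqP -> : coprimep (map_poly intr Q1) (('X - (-1)%:P) ^+ N : {poly 'F_p}) by [].
rewrite coprimep_pexpr // coprimep_XsubC rootE rmorphD rmorphM /= hornerD hornerM D0.
by rewrite mulr0 addr0.
Qed.

(** * Kronecker approximation *)

Section Bohr.
Variable F : numFieldType.
Hypothesis arch : forall x : F, exists n, `|x| < n%:R.

Lemma bernoulli_ineq (x : F) (n : nat) : 0 <= x -> 1 + n%:R * x <= (1 + x) ^+ n.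
Proof.
move=> x0; elim: n => [|n IHn]; first by rewrite mul0r addr0 expr0.
rewrite exprS; apply: le_trans (ler_wpM2l _ IHn); last by rewrite addr_ge0.
rewrite -subr_ge0 [X in 0 <= X](_ : _ = n%:R * x ^+ 2); last first.
  by rewrite -natr1 expr2 !mulrDr !mulrDl !mul1r !mulr1 mulrCA; ring.
by rewrite mulr_ge0 ?exprn_ge0.
Qed.

(** An exponential outgrows every polynomial; in [sum_unit_near_card] this beats the number of
    letter counts of words of length k. *)
Lemma pow_lt_exp (d : nat) (r : F) :
  (0 < d)%N -> 1 < r -> exists k, (k.+1 ^ d)%:R < r ^+ k.
Proof.
move=> d0 r1; pose x := r - 1; have x0 : 0 < x by rewrite subr_gt0.
have [q qP] := arch ((2 * d)%:R / x ^+ 2).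
(* With k = 2dq, taking d-th roots leaves 2qd + 1 < (r^q)^2. Bernoulli gives (r^q)^2 >= (1 + qx)^2,
   so q x^2 >= 2d suffices. *)
exists (2 * d * q)%N.
have q0 : (0 < q)%N by rewrite -(ltr0n F); apply: le_lt_trans qP.
have {qP} qP : (2 * d)%:R <= q%:R * x ^+ 2.
  rewrite -ler_pdivrMr ?exprn_gt0 //; apply/ltW; move: qP.
  by rewrite ger0_norm // divr_ge0 // exprn_ge0 // ltW.
rewrite natrX mulnAC exprM ltrXn2r -?lt0n //.
rewrite [(2 * q)%N]mulnC exprM -natr1.
have rq : (1 + q%:R * x) ^+ 2 <= (r ^+ q) ^+ 2.
  have x0' := ltW x0; apply: lerXn2r; rewrite ?nnegrE ?addr_ge0 ?mulr_ge0 //.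
    by rewrite exprn_ge0 // ltW // (lt_trans ltr01).
  by have -> : r = 1 + x; [rewrite /x addrC subrK | exact: bernoulli_ineq].
apply: lt_le_trans rq.
rewrite -subr_gt0.
rewrite [ltRHS](_ : _ = 2 * q%:R * x + q%:R * (q%:R * x ^+ 2 - (2 * d)%:R)); last first.
  by rewrite !natrM; ring.
by rewrite ltr_wpDr ?mulr_gt0 ?mulr_ge0 ?subr_ge0 ?ltr0n.
Qed.

Lemma norm_geometric_sum_le (L : nat) (u : F) : `|u| = 1 -> u != 1 ->
  `|\sum_(t < L) u ^+ t| <= 2 / `|u - 1|.
Proof.
move=> u1 un1; rewrite ler_pdivlMr ?normr_gt0 ?subr_eq0 //.
rewrite -normrM mulrC -subrX1 (le_trans (ler_normB _ _)) //.
by rewrite normrX u1 normr1 expr1n.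
Qed.

Section Words.
Variables (J : finType) (x w : J -> F) (c : F).
Hypothesis x1 : forall j, `|x j| = 1.
Hypothesis w1 : forall j, `|w j| = 1.
Hypothesis xw : forall a b : J -> nat,
  \prod_j x j ^+ a j = \prod_j x j ^+ b j -> \prod_j w j ^+ a j = \prod_j w j ^+ b j.
Hypothesis c_ge0 : 0 <= c.
Hypothesis sum_le : forall t, `|\sum_j x j ^+ t * w j| <= c.

Variable k : nat.
Let word := {ffun 'I_k -> J}.
Let monom (z : J -> F) (f : word) := \prod_i z (f i).
Let count_letter (f : word) (j : J) := #|[pred i | f i == j]|.

Let monomE z f : monom z f = \prod_j z j ^+ count_letter f j.
Proof.
rewrite /monom (partition_big f predT) //=; apply: eq_bigr => j _.
by rewrite (eq_bigr (fun=> z j)) ?prodr_const // => i /eqP ->.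
Qed.

Let norm_monom z f : (forall j, `|z j| = 1) -> `|monom z f| = 1.
Proof. by move=> z1; rewrite normr_prod big1. Qed.

(* Average (sum_j x_j^t w_j)^k / (X^t W) over t < L, where X and W are the values of
   the word f0: words with value X contribute 1 each, the others a bounded sum. *)
Let class_le (f0 : word) : #|[pred f | monom x f == monom x f0]|%:R <= c ^+ k.
Proof.
set A := [pred f | _].
pose B := \sum_(f | f \notin A) 2 / `|monom x f / monom x f0 - 1|.
have x0 f : monom x f != 0 by rewrite -normr_gt0 norm_monom.
have w0 f : monom w f != 0 by rewrite -normr_gt0 norm_monom.
(* [B] does not depend on L, so dividing by L and letting L grow gives the claim. *)
have main L : L%:R * #|A|%:R <= L%:R * c ^+ k + B.
  have E : \sum_(t < L) (\sum_j x j ^+ t * w j) ^+ k / (monom x f0 ^+ t * monom w f0)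
    = \sum_f monom w f / monom w f0 * \sum_(t < L) (monom x f / monom x f0) ^+ t.
    under [RHS]eq_bigr do rewrite big_distrr.
    rewrite exchange_big /=; apply: eq_bigr => t _.
    rewrite -[in LHS](card_ord k) -prodr_const bigA_distr_bigA big_distrl /=.
    apply: eq_bigr => f _; rewrite big_split /= prodrXl.
    rewrite -/(monom x f) -/(monom w f) exprMn exprVn invfM.
    by ring.
  have E1 : \sum_(f in A) monom w f / monom w f0 * \sum_(t < L) (monom x f / monom x f0) ^+ t
     = L%:R * #|A|%:R.
    rewrite (eq_bigr (fun=> L%:R)) => [|f /eqP fA].
      by rewrite sumr_const mulr_natr.
    (* By [xw], words with the same x-value have the same w-value, so every quotient here is 1. *)
    have -> : monom w f = monom w f0 by move: fA; rewrite !monomE; apply: xw.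
    rewrite fA !divff // mul1r (eq_bigr (fun=> 1)) => [|i _]; last by rewrite expr1n.
    by rewrite sumr_const card_ord.
  have -> : L%:R * #|A|%:R = `|L%:R * #|A|%:R : F| by rewrite ger0_norm // mulr_ge0.
  have -> : L%:R * #|A|%:R =
     \sum_(t < L) (\sum_j x j ^+ t * w j) ^+ k / (monom x f0 ^+ t * monom w f0)
     - \sum_(f | f \notin A) monom w f / monom w f0 * \sum_(t < L) (monom x f / monom x f0) ^+ t.
    by rewrite E (bigID (mem A)) /= E1 addrK.
  apply: le_trans (ler_normB _ _) (lerD _ _).
    apply: le_trans (ler_norm_sum _ _ _) _.
    rewrite mulr_natl -[in leRHS](card_ord L) -sumr_const ler_sum // => t _.
    rewrite normrM normfV normrM !normrX !norm_monom // expr1n mulr1 divr1.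
    by apply: lerXn2r; rewrite ?nnegrE.
  apply: le_trans (ler_norm_sum _ _ _) _; apply: ler_sum => f fA.
  rewrite normrM normf_div !norm_monom // divr1 mul1r norm_geometric_sum_le //.
    by rewrite normf_div !norm_monom // divr1.
  by apply: contraNneq fA => /divr1_eq/eqP.
rewrite real_leNgt ?realn ?realX ?ger0_real //; apply/negP; rewrite -subr_gt0 => gap.
have B_ge0 : 0 <= B by apply: sumr_ge0 => f _; rewrite divr_ge0.
have [L] := arch (B / (#|A|%:R - c ^+ k)).
rewrite ger0_norm ?divr_ge0 ?(ltW gap) // ltr_pdivrMr // mulrBr ltrBrDl.
by move=> /lt_le_trans /(_ (main L)); rewrite ltxx.
Qed.

(* The value of a word depends only on its letter counts. *)
Lemma word_count_le : (#|J| ^ k)%:R <= (k.+1 ^ #|J|)%:R * c ^+ k.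
Proof.
pose cnt (f : word) := [ffun j => inord (count_letter f j) : 'I_k.+1].
have cntE f j : cnt f j = count_letter f j :> nat.
  by rewrite ffunE inordK // ltnS -[leqRHS]card_ord max_card.
rewrite -[k in (#|J| ^ k)%N]card_ord -card_ffun -sum1_card.
rewrite (partition_big cnt predT) //= natr_sum.
have -> : (k.+1 ^ #|J|)%N = #|{ffun J -> 'I_k.+1}| by rewrite card_ffun card_ord.
rewrite mulr_natl -sumr_const ler_sum // => v _.
have [f0 /eqP f0v|none] := pickP (fun f => cnt f == v); last first.
  by rewrite big_pred0 ?exprn_ge0.
apply: le_trans (class_le f0); rewrite ler_nat sum1_card.
apply/subset_leq_card/fintype.subsetP => f fv; apply/eqP.
have {}fv : cnt f = v by apply/eqP.
by rewrite !monomE; apply: eq_bigr => j _; rewrite -!cntE fv f0v.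
Qed.

End Words.

(** If every sum had modulus at most c, [word_count_le] would give (#|J| / c)^k <= (k + 1)^#|J| for
    all k, an exponential bounded by a polynomial. *)
Lemma sum_unit_near_card (J : finType) (x w : J -> F) (c : F) :
  (forall j, `|x j| = 1) -> (forall j, `|w j| = 1) ->
  (forall a b : J -> nat,
     \prod_j x j ^+ a j = \prod_j x j ^+ b j -> \prod_j w j ^+ a j = \prod_j w j ^+ b j) ->
  0 < c -> c < #|J|%:R -> exists t, c < `|\sum_j x j ^+ t * w j|.
Proof.
move=> x1 w1 xw c0 cJ; apply: contrapT => /forallNP large.
have small t : `|\sum_j x j ^+ t * w j| <= c.
  rewrite real_leNgt ?ger0_real ?(ltW c0) //; apply/negP; exact: large.
have J0 : (0 < #|J|)%N by rewrite -(ltr0n F) (lt_trans c0).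
have r1 : 1 < #|J|%:R / c by rewrite ltr_pdivlMr ?mul1r.
have [k] := pow_lt_exp J0 r1.
rewrite expr_div_n ltr_pdivlMr ?exprn_gt0 //.
by rewrite -natrX => /(le_lt_trans (word_count_le x1 w1 xw (ltW c0) small k)); rewrite ltxx.
Qed.

End Bohr.

Lemma prod_option (A : comPzSemiRingType) (J : finType) (G : option J -> A) :
  \prod_o G o = G None * \prod_j G (Some j).
Proof.
rewrite (bigD1 None) //=; congr (_ * _).
rewrite (reindex_omap Some id) /=; last by case.
by apply: eq_bigl => j; rewrite eqxx.
Qed.

(** When the modulus of a sum of unit numbers is close to the number of terms, the terms are close
    to each other; this is applied to 1 and the ratios x_j^t / z_j. Natural exponents on both sides
    of a relation encode integer exponents. *)
Lemma kronecker_approximation (C : numClosedFieldType) (J : finType) (x z : J -> C) (e : C) :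
  (forall y : C, exists n, `|y| < n%:R) ->
  (forall j, `|x j| = 1) -> (forall j, `|z j| = 1) ->
  (forall a b : J -> nat,
     \prod_j x j ^+ a j = \prod_j x j ^+ b j -> \prod_j z j ^+ a j = \prod_j z j ^+ b j) ->
  0 < e -> exists t, forall j, `|x j ^+ t - z j| < e.
Proof.
move=> arch x1 z1 xz e0.
(* The sum detects only relative phases; an extra term equal to 1 fixes the absolute one. *)
pose x' (o : option J) := oapp x 1 o; pose w' (o : option J) := oapp (fun j => (z j)^-1) 1 o.
have x'1 o : `|x' o| = 1 by case: o => [j|] /=; rewrite ?x1 ?normr1.
have w'1 o : `|w' o| = 1 by case: o => [j|] /=; rewrite ?normfV ?z1 ?invr1 ?normr1.
have x'w' (a b : option J -> nat) :
    \prod_o x' o ^+ a o = \prod_o x' o ^+ b o -> \prod_o w' o ^+ a o = \prod_o w' o ^+ b o.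
  rewrite !prod_option /= !expr1n !mul1r => /xz.
  have prodV (l : J -> nat) : \prod_j (z j)^-1 ^+ l j = (\prod_j z j ^+ l j)^-1.
    by rewrite -prodfV; apply: eq_bigr => j _; rewrite exprVn.
  by rewrite !prodV => ->.
(* Chosen so that both d < 1 and 4d <= e^2. *)
pose d := e ^+ 2 / (4 + e ^+ 2).
have e2 : 0 < e ^+ 2 by rewrite exprn_gt0.
have e4 : 0 < 4 + e ^+ 2 by rewrite addr_gt0.
have d0 : 0 < d by rewrite divr_gt0.
have d1 : d < 1 by rewrite ltr_pdivrMr // mul1r ltrDr.
have d4 : 4 * d <= e ^+ 2.
  by rewrite mulrA ler_pdivrMr // mulrDr [leLHS]mulrC lerDl mulr_ge0 ?ltW.
have card_gt d' : d' < 1 -> 0 < #|{: option J}|%:R - d' :> C.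
  by move=> d'1; rewrite card_option -natr1 -addrA ltr_wpDl // subr_gt0.
have [t ht] : exists t, #|{: option J}|%:R - d < `|\sum_o x' o ^+ t * w' o|.
  by apply: (sum_unit_near_card arch x'1 w'1 x'w' (card_gt _ d1)); rewrite gtrBl.
exists t => j; set u := x j ^+ t / z j.
have z0 : z j != 0 by rewrite -normr_gt0 z1.
have u1 : `|u| = 1 by rewrite normf_div normrX x1 z1 expr1n divr1.
have -> : `|x j ^+ t - z j| = `|1 - u|.
  have -> : x j ^+ t - z j = (u - 1) * z j by rewrite mulrBl mul1r divfK.
  by rewrite normrM z1 mulr1 distrC.
(* The terms other than 1 and u have modulus 1, so by the triangle inequality the whole defect d
   bounds that of 1 + u. *)
have u2 : 2 - d < `|1 + u|.
  rewrite -(ltrD2r (#|{: option J}|%:R - 2)).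
  rewrite [ltLHS](_ : _ = #|{: option J}|%:R - d); last by ring.
  apply: lt_le_trans ht _.
  rewrite (bigD1 None) //= (bigD1 (Some j)) //= expr1n mul1r addrA.
  apply: le_trans (ler_normD _ _) (lerD _ _) => //.
  apply: le_trans (ler_norm_sum _ _ _) _.
  rewrite (eq_bigr (fun=> 1)) => [|o _]; last by rewrite normrM normrX x'1 w'1 expr1n mul1r.
  set S := \sum_(o | _) 1; suff -> : #|{: option J}|%:R = 2 + S by rewrite addrAC subrr add0r.
  by rewrite -[LHS]/(1 *+ _) -sumr_const (bigD1 None) //= (bigD1 (Some j)) //= addrA.
(* The parallelogram law turns the lower bound on |1 + u| into |1 - u|^2 < 4 - (2 - d)^2 <= 4d. *)
have u3 : `|1 + u| ^+ 2 + `|1 - u| ^+ 2 = 4.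
  have uu : u * u^* = 1 by rewrite -normCK u1 expr1n.
  rewrite !normCK !rmorphD rmorphN rmorph1 /=.
  by rewrite [LHS](_ : _ = 2 + 2 * (u * u^*)); [rewrite uu; ring | ring].
rewrite -(ltr_pXn2r (ltn0Sn 1)) ?nnegrE ?normr_ge0 ?(ltW e0) //.
apply: lt_le_trans d4.
have u4 : (2 - d) ^+ 2 < `|1 + u| ^+ 2.
  by rewrite ltrXn2r // subr_ge0 ltW // (lt_trans d1) // ltr1n.
have -> : `|1 - u| ^+ 2 = 4 - `|1 + u| ^+ 2 by rewrite -u3 addrAC subrr add0r.
rewrite ltrBlDl; apply: (@le_lt_trans _ _ ((2 - d) ^+ 2 + 4 * d)); last by rewrite ltrD2r.
by rewrite -subr_ge0 [X in 0 <= X](_ : _ = d ^+ 2); [rewrite exprn_ge0 // ltW | ring].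
Qed.

(** * The exponential series on the imaginary axis *)

Section Cis.
Local Open Scope classical_set_scope.
Local Open Scope complex_scope.
Local Open Scope ring_scope.
Variable R : realType.
Local Notation C := (R[i] : numFieldType).

Lemma complex_archimedean (x : R[i]) : exists n, `|x| < n%:R.
Proof.
exists (Num.bound (ComplexField.Normc.normc x)).
rewrite -(rmorph_nat (real_complex R)) ltcR; apply: archi_boundP.
by rewrite -ler0c; apply: (normr_ge0 x).
Qed.

Definition cis (x : R) : R[i] := cos x +i* sin x.

Lemma cis0 : cis 0 = 1.
Proof. by rewrite /cis cos0 sin0. Qed.

Lemma cisD x y : cis (x + y) = cis x * cis y.
Proof. by rewrite /cis cosD sinD; apply/eqP; rewrite eq_complex /= eqxx /= addrC. Qed.

Lemma cisX x k : cis x ^+ k = cis (k%:R * x).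
Proof.
elim: k => [|k IHk]; first by rewrite mul0r cis0.
by rewrite exprS IHk -cisD -nat1r mulrDl mul1r.
Qed.

Lemma cis_prod (J : finType) (f : J -> R) : \prod_j cis (f j) = cis (\sum_j f j).
Proof. by rewrite (big_morph cis cisD cis0). Qed.

Lemma norm_cis x : `|cis x| = 1.
Proof. by rewrite normc_def /= cos2Dsin2 sqrtr1. Qed.

Lemma cis_2pi_int (z : int) : cis (2 * pi * z%:~R) = 1.
Proof.
have cis2pi : cis (2 * pi) = 1.
  by rewrite /cis mulr_natl cos2pi sin2pi.
have cisn n : cis (2 * pi * n%:R) = 1 by rewrite mulrC -cisX cis2pi expr1n.
case: z => n; first exact: cisn.
rewrite NegzE mulrNz mulrN.
by apply: (mulfI (oner_neq0 _)); rewrite -{1}(cisn n.+1) -cisD subrr cis0 mulr1.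
Qed.

(** The fractional part y of x satisfies sin(pi y) = 0 by the double angle formula, while sin is
    positive on (0, pi); hence y = 0. *)
Lemma cis_2pi_eq1 x : cis (2 * pi * x) = 1 -> exists z : int, x = z%:~R.
Proof.
move=> cx; exists (Num.floor x); apply/eqP; rewrite -subr_eq0.
set y := x - _; have y0 : 0 <= y by rewrite subr_ge0 floor_le.
have y1 : y < 1 by rewrite ltrBlDr addrC -intrD1 floorD1_gt.
have : cis (2 * pi * y) = 1.
  by rewrite mulrBr -mulrN -mulrNz cisD cx cis_2pi_int mulr1.
case=> + _; rewrite -mulrA mulr_natl cos_mulr2n.
move=> c2; have s0 : sin (pi * y) = 0.
  apply/eqP; rewrite -sqrf_eq0 sin2cos2.
  by apply/eqP; lra.
have [//|yn0] := eqVneq y 0.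
have : 0 < sin (pi * y).
  apply: sin_gt0_pi; rewrite mulr_gt0 ?pi_gt0 ?lt_def ?yn0 //=.
  by rewrite -lt_def gtr_pMr ?pi_gt0.
by rewrite s0 ltxx.
Qed.

Lemma cvg_real_complex (u : R^nat) (l : R) : u @ \oo --> l ->
  (fun k => (u k)%:C : C) @ \oo --> (l%:C : C).
Proof.
move=> /cvgrPdist_lt ul; apply/cvgrPdist_lt => e e0.
(* A positive element of [R[i]] is real, so the tolerance comes from [R]. *)
have eE : (complex.Re e)%:C = e by rewrite RRe_real // gtr0_real.
have : 0 < complex.Re e by rewrite -(ltcR 0) eE.
move=> /ul; apply: filterS => k.
by rewrite -rmorphB /= normc_def /= expr0n addr0 sqrtr_sqr -{2}eE ltcR.
Qed.

(** Separating even and odd powers of 'i turns the partial sums into those of the cosine and sine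
    series. *)
Lemma cvg_exp_series_cis (x : R) :
  series (fun k => k`!%:R^-1 * ('i * x%:C) ^+ k : C) @ \oo --> (cis x : C).
Proof.
have -> : series (fun k => k`!%:R^-1 * ('i * x%:C) ^+ k : C) =
   (fun k => (series (cos_coeff x) k)%:C + 'i * (series (sin_coeff x) k)%:C).
  apply/funext => k; rewrite /series /= !rmorph_sum mulr_sumr -big_split /=.
  apply: eq_bigr => i _.
  have iE : ('i : R[i]) ^+ i = (-1) ^+ i./2 * (if odd i then 'i else 1).
    rewrite -{1}(odd_double_half i) exprD -mul2n exprM sqr_i mulrC.
    by case: odd; rewrite ?expr1 ?expr0.
  have i2 : odd i -> i.-1./2 = i./2.
    by move=> i_odd; rewrite -{1}(odd_double_half i) i_odd add1n /= doubleK.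
  rewrite exprMn iE /cos_coeff /sin_coeff /=.
  rewrite !rmorphM !fmorphV !rmorph_nat !rmorphXn /= !rmorphN1.
  case: (odd i) i2 => i2 /=; last by rewrite !mul0r mulr0 addr0; ring.
  by rewrite i2 // !mul0r add0r; ring.
have cosx : (fun k => (series (cos_coeff x) k)%:C : C) @ \oo --> ((cos x)%:C : C).
  by apply: cvg_real_complex; rewrite cos.unlock; exact: is_cvg_series_cos_coeff.
have sinx : (fun k => (series (sin_coeff x) k)%:C : C) @ \oo --> ((sin x)%:C : C).
  by apply: cvg_real_complex; rewrite sin.unlock; exact: is_cvg_series_sin_coeff.
rewrite [cis x]complexE /=.
exact: cvgD cosx (cvgMl_tmp (a := 'i : C) sinx).
Qed.
End Cis.

(** * Spectrum of circulant graphs *)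

Section Spectral.
Local Open Scope classical_set_scope.
Local Open Scope ring_scope.
Variable K : numFieldType.

Lemma cvg_linear_combination (V : normedModType K) (J : finType)
    (z : J -> nat -> K) (l : J -> K) (v : J -> V) :
  (forall j, z j @ \oo --> l j) ->
  (fun r => \sum_j z j r *: v j) @ \oo --> \sum_j l j *: v j.
Proof.
move=> zl; apply: cvg_big => [|j _]; first exact: add_continuous.
exact: cvgZr_tmp.
Qed.

(** Multiplying the resolution of the identity by M^k gives M^k as the sum of the c_j^k E_j, so the
    matrix series splits into scalar ones. *)
Lemma expmx_spectral (n : nat) (M : 'M[K]_n.+1) (J : finType)
    (E : J -> 'M[K]_n.+1) (c z : J -> K) :
  \sum_j E j = 1%:M -> (forall j, M *m E j = c j *: E j) ->
  (forall j, series (fun k => k`!%:R^-1 * c j ^+ k) @ \oo --> z j) ->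
  expmx M = \sum_j z j *: E j.
Proof.
move=> E1 ME cz; apply: cvg_lim; first exact: norm_hausdorff.
have powM k : M ^+ k = \sum_j c j ^+ k *: E j.
  elim: k => [|k IHk].
    by rewrite expr0 -[LHS]E1; apply: eq_bigr => j _; rewrite expr0 scale1r.
  rewrite exprS IHk -[_ * _]/(_ *m _) mulmx_sumr; apply: eq_bigr => j _.
  by rewrite -scalemxAr ME scalerA exprSr.
have -> : series (fun k => k`!%:R^-1 *: M ^+ k) =
    (fun N => \sum_j series (fun k => k`!%:R^-1 * c j ^+ k) N *: E j).
  apply/funext => N; rewrite /series /= (eq_bigr _ (fun k _ => congr1 _ (powM k))).
  under eq_bigr do rewrite scaler_sumr.
  rewrite exchange_big /=; apply: eq_bigr => j _.
  by rewrite scaler_suml; apply: eq_bigr => k _; rewrite scalerA.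
exact: cvg_linear_combination.
Qed.

End Spectral.

Section Characters.
Variables (K : numFieldType) (n : nat) (w : K).
Local Notation q := (Zp_trunc n).+2.
Hypothesis w_prim : q.-primitive_root w.

(** The additive character a -> w^(ja), computed on representatives; since w has order [q], only
    their residues matter. *)
Definition zchar (j a : 'Z_n) : K := w ^+ (j * a)%N.

Lemma zcharD j : {morph zchar j : a b / a + b >-> a * b}.
Proof.
move=> a b; rewrite /zchar -exprD -mulnDr -(prim_expr_mod w_prim).
by rewrite -[in RHS](prim_expr_mod w_prim) /= modnMmr.
Qed.

Lemma zchar0 j : zchar j 0 = 1.
Proof. by rewrite /zchar muln0. Qed.

(** Orthogonality of characters: for nonzero a the sum is geometric with ratio w^a other than 1, and
    w^a - 1 annihilates it. *)
Lemma sum_zchar a : \sum_j zchar j a = q%:R *+ (a == 0).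
Proof.
have [->|a0] := eqVneq a 0.
  by rewrite (eq_bigr (fun=> 1)) => [|j _]; rewrite ?zchar0 // sumr_const card_ord.
have wa1 : w ^+ a != 1.
  rewrite -(prim_order_dvd w_prim) gtnNdvd ?ltn_ord // lt0n.
  by apply: contraNneq a0 => a0; apply/eqP/val_inj.
apply: (mulfI (x := w ^+ a - 1)); first by rewrite subr_eq0.
rewrite mulr0 (eq_bigr (fun j : 'I_q => (w ^+ a) ^+ j)) => [|j _]; last first.
  by rewrite -exprM mulnC.
by rewrite -subrX1 exprAC (prim_expr_order w_prim) expr1n subrr.
Qed.

Lemma zcharC j a : zchar j a = zchar a j.
Proof. by rewrite /zchar mulnC. Qed.

(** The rank-one projection onto the line of the character j, with zchar j a * (zchar j b)^-1
    written as a function of a - b. *)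
Definition eigenproj (j : 'Z_n) : 'M[K]_q := \matrix_(a, b) (q%:R^-1 * zchar j (a - b)).

Lemma sum_eigenproj : \sum_j eigenproj j = 1%:M.
Proof.
apply/matrixP => a b; rewrite summxE mxE.
under eq_bigr do rewrite mxE.
rewrite -mulr_sumr sum_zchar subr_eq0.
by case: eqP => _; rewrite ?mulr0 // mulVf // pnatr_eq0.
Qed.

End Characters.

Section CirculantTransition.
Local Open Scope complex_scope.
Local Open Scope ring_scope.
Variables (R : realType) (n : nat) (w : R[i]).
Local Notation q := (Zp_trunc n).+2.
Hypothesis w_prim : q.-primitive_root w.

(** The columns of [eigenproj w j] are multiples of a character, and translation by x multiplies a
    character by its value at x. *)
Lemma adjacency_circulant_eigenproj (T : {set 'Z_n}) j : 0 \notin T ->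
  adjacency_mx R (circulant T) *m eigenproj w j = (\sum_(x in T) zchar w j x) *: eigenproj w j.
Proof.
move=> T0; apply/matrixP => a b; rewrite !mxE.
rewrite (reindex_inj (addrI a)) /= mulr_suml [RHS]big_mkcond /=.
apply: eq_bigr => x _; rewrite !mxE /circulant addrC addrK.
have -> : (a != x + a) && (x \in T) = (x \in T).
  case xT : (x \in T); rewrite ?andbF // andbT -subr_eq0 opprD addrCA subrr addr0 oppr_eq0.
  by apply: contraNneq T0 => <-.
case: ifP => _; rewrite ?mul0r // mul1r mulrCA; congr (_ * _).
by rewrite -(zcharD w_prim) addrA.
Qed.

Lemma transition_circulant (T : {set 'Z_n}) (mu : 'Z_n -> R) (t : R) : 0 \notin T ->
  (forall j, \sum_(x in T) zchar w j x = (mu j)%:C) ->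
  transition_mx (circulant T) t = \sum_j cis (- (t * mu j)) *: eigenproj w j.
Proof.
move=> T0 muE; apply: (expmx_spectral (c := fun j => 'i * (- (t * mu j))%:C)).
- exact: sum_eigenproj.
- move=> j; rewrite -scalemxAl adjacency_circulant_eigenproj // scalerA muE.
  by rewrite rmorphN rmorphM /= mulrN mulrA mulNr.
- by move=> j; apply: cvg_exp_series_cis.
Qed.

End CirculantTransition.

Lemma cis_primitive_root (R : realType) (n : nat) : (0 < n)%N ->
  n.-primitive_root (cis (2 * pi * n%:R^-1) : R[i]).
Proof.
move=> n0; set w := cis _.
have cisXn k : w ^+ k = cis (2 * pi * (k%:R / n%:R)) by rewrite cisX; congr cis; ring.
have n_neq0 : n%:R != 0 :> R by rewrite pnatr_eq0 -lt0n.
have wn : w ^+ n = 1 by rewrite cisXn divff // -[1](mulr1z 1) cis_2pi_int.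
have [m w_prim m_dvd] := prim_order_exists n0 wn.
suff n_dvd : (n %| m)%N.
  by have /eqP <- : m == n by rewrite eqn_dvd m_dvd.
have := prim_expr_order w_prim; rewrite cisXn => /cis_2pi_eq1 [z zE].
have : (m : int) = z * n.
  by apply: (@intr_inj R); rewrite intrM /= -zE divfK.
by move=> /(congr1 absz); rewrite abszM /= => ->; rewrite dvdn_mull.
Qed.

Lemma zcharN (K : numFieldType) (n : nat) (w : K) : (Zp_trunc n).+2.-primitive_root w ->
  forall j a : 'Z_n, zchar w j (- a) = (zchar w j a)^-1.
Proof.
move=> w_prim j a.
have aa1 : zchar w j a * zchar w j (- a) = 1 by rewrite -(zcharD w_prim) subrr zchar0.
have za : zchar w j a != 0.
  by apply/eqP => za0; move: aa1; rewrite za0 mul0r => /esym/eqP; rewrite oner_eq0.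
by apply: (mulfI za); rewrite aa1 divff.
Qed.

(** * The connection set of powers of p *)

Section Connection.
Local Open Scope classical_set_scope.
Local Open Scope complex_scope.
Local Open Scope ring_scope.
Variables (p s n m : nat) (k : 'I_m.+1 -> nat).
Hypothesis p_prime : prime p.
Hypothesis p_odd : odd p.
Hypothesis nE : n = (2 * p ^ s)%N.
Hypothesis k_incr : forall i j : 'I_m.+1, (i < j)%N -> (k i < k j)%N.
Hypothesis k_max : (k ord_max < s)%N.

Let a (i : 'I_m.+1) : 'Z_n := (p ^ k i)%:R.
Let S : {set 'Z_n} := [set (p ^ k i)%:R | i : 'I_m.+1]
              :|: [set (n - p ^ k i)%N%:R | i : 'I_m.+1].

Let n_gt1 : (1 < n)%N.
Proof. by have : (0 < p ^ s)%N; [rewrite expn_gt0 prime_gt0 | rewrite nE; lia]. Qed.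

Let qE : (Zp_trunc n).+2 = n.
Proof. exact: Zp_cast. Qed.

Let k_lt i : (k i < s)%N.
Proof.
apply: leq_ltn_trans k_max; have [->//|i_neq] := eqVneq i ord_max.
by apply/ltnW/k_incr; rewrite ltn_neqAle i_neq -ltnS ltn_ord.
Qed.

Let pk_lt i : (p ^ k i < p ^ s)%N.
Proof. by rewrite ltn_exp2l ?prime_gt1. Qed.

Let pk_gt0 i : (0 < p ^ k i)%N.
Proof. by rewrite expn_gt0 prime_gt0. Qed.

Let pk_ltn i : (p ^ k i < n)%N.
Proof. by rewrite nE mul2n -addnn ltn_addr. Qed.

Let pk_le i : (p ^ k i <= n)%N.
Proof. exact: ltnW (pk_ltn i). Qed.

Let val_a i : a i = (p ^ k i)%N :> nat.
Proof. by rewrite val_Zp_nat // modn_small. Qed.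

Let val_aN i : ((n - p ^ k i)%N%:R : 'Z_n) = (n - p ^ k i)%N :> nat.
Proof. by rewrite val_Zp_nat // modn_small // ltn_subrL pk_gt0 ltnW. Qed.

Let aN i : (n - p ^ k i)%N%:R = - a i.
Proof.
have n0 : n%:R = 0 :> 'Z_n by apply/val_inj; rewrite /= val_Zp_nat // modnn.
by rewrite (natrB _ (pk_le i)) n0 sub0r.
Qed.

Let k_inj : injective k.
Proof.
move=> i j kij; apply/val_inj; case: (ltngtP i j) => // /k_incr; by rewrite kij ltnn.
Qed.

Let a_inj : injective a.
Proof.
move=> i j /(congr1 val) /=; rewrite !val_a => /eqP.
by rewrite eqn_exp2l ?prime_gt1 // => /eqP/k_inj.
Qed.

(** Oddness of x turns w^(jx) into (-1)^j when w is replaced by -1; it also keeps 0 out of [S]. *)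
Lemma connection_odd x : x \in S -> odd x.
Proof.
have pk_odd i : odd (p ^ k i) by rewrite oddX p_odd orbT.
case/setUP => /imsetP[i _ ->]; first by rewrite val_a.
by rewrite val_aN (oddB (pk_le i)) pk_odd addbT nE oddM.
Qed.

Lemma sum_connection (A : nmodType) (F : 'Z_n -> A) :
  \sum_(x in S) F x = \sum_i (F (a i) + F (- a i)).
Proof.
under eq_bigl do rewrite finset.in_setU.
rewrite bigU /=; last first.
  rewrite -finset.setI_eq0; apply/eqP/finset.setP => x; rewrite !inE; apply/negP.
  case/andP => /imsetP[i _ ->] /imsetP[j _].
  move/(congr1 val); rewrite /= val_a val_aN => pkij.
  (* Both powers lie below p^s = n/2, so p^(k i) cannot equal n - p^(k j). *)
  have := pk_lt i; have := pk_lt j.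
  have := pk_ltn j; lia.
rewrite big_split /= !big_imset /= => [|i j _ _|i j _ _ /a_inj //]; last first.
  by rewrite !aN => /oppr_inj/a_inj.
by congr (_ + _); apply: eq_bigr => i _; rewrite aN.
Qed.

Lemma card_connection : #|S| = (2 * m.+1)%N.
Proof.
rewrite -sum1_card (sum_connection (fun=> 1%N)).
by rewrite sum_nat_const card_ord mulnC.
Qed.

Lemma prim_expr_half (K : numFieldType) (w : K) :
  (Zp_trunc n).+2.-primitive_root w -> w ^+ (p ^ s) = -1.
Proof.
move=> w_prim'; have w_prim : n.-primitive_root w by rewrite -{1}qE.
have /eqP : w ^+ (p ^ s) ^+ 2 = 1.
  by rewrite -exprM mulnC -nE (prim_expr_order w_prim).
rewrite sqrf_eq1 => /orP[|/eqP //]; rewrite -(prim_order_dvd w_prim) nE.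
by move=> /dvdn_leq; rewrite expn_gt0 prime_gt0 // => /(_ isT); lia.
Qed.

(** The relation says that an integer polynomial Q vanishes at w. Each exponent jx has the parity of
    j, so Q(-1) is the sum in the conclusion minus p r. *)
Lemma zchar_relation_dvd (K : numFieldType) (w : K) (l : 'Z_n -> int) (r : int) :
  (Zp_trunc n).+2.-primitive_root w ->
  \sum_j (l j)%:~R * (1 + \sum_(x in S) zchar w j x) = (p%:Z * r)%:~R ->
  (p %| \sum_j l j * (1 + (2 * m.+1)%:Z * (-1) ^+ (j : 'Z_n)))%Z.
Proof.
move=> /prim_expr_half wN rel.
pose Q : {poly int} := \sum_j l j *: (1 + \sum_(x in S) 'X^(j * x)%N) - (p%:Z * r)%:P.
have Qw : root (map_poly intr Q) w.
  apply/rootP; rewrite /Q rmorphB /= map_polyC /= hornerD hornerN hornerC -rel.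
  rewrite rmorph_sum horner_sum -sumrB big1 // => j _.
  rewrite /= map_polyZ hornerZ rmorphD rmorph1 rmorph_sum /= hornerD hornerC.
  rewrite horner_sum; apply/eqP; rewrite subr_eq0; apply/eqP.
  congr (_ * (1 + _)); apply: eq_bigr => x _.
  by rewrite map_polyXn hornerXn.
have := dvdz_eval_opp1 p_prime wN Qw.
rewrite hornerD hornerN hornerC rpredBr ?dvdz_mulr // horner_sum.
congr (_ %| _)%Z; apply: eq_bigr => j _.
rewrite hornerZ hornerD hornerC horner_sum; congr (_ * (_ + _)).
rewrite (eq_bigr (fun=> (-1) ^+ (j : 'Z_n))) => [|x /connection_odd x_odd].
  by rewrite sumr_const card_connection -mulr_natl natz.
by rewrite hornerXn -[LHS]signr_odd oddM x_odd andbT signr_odd.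
Qed.

(** * Revival between the antipodal vertices *)

Section Revival.
Variable R : realType.

Let w : R[i] := cis (2 * pi * ((Zp_trunc n).+2)%:R^-1).

Let w_prim : (Zp_trunc n).+2.-primitive_root w.
Proof. exact: cis_primitive_root. Qed.

(** As [S] is closed under negation, conjugate character values pair up and the eigenvalue is
    real. *)
Let lam (j : 'Z_n) : R := \sum_i 2 * complex.Re (zchar w j (a i)).

Let sum_zchar_connection j : \sum_(x in S) zchar w j x = (lam j)%:C.
Proof.
rewrite sum_connection rmorph_sum; apply: eq_bigr => i _ /=.
rewrite (zcharN w_prim) invc_norm normrX norm_cis !expr1n invr1 mul1r.
by rewrite addcJ rmorphM rmorph_nat.
Qed.

Let S0 : 0 \notin S.
Proof. by apply/negP => /connection_odd. Qed.

Let T := ~: (0 |: S).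

Let T0 : 0 \notin T.
Proof. by rewrite !inE eqxx. Qed.

Let mu (j : 'Z_n) : R := (n * (j == 0%R))%N%:R - (1 + lam j).

Let sum_zchar_complement j : \sum_(x in T) zchar w j x = (mu j)%:C.
Proof.
have : \sum_(x in 0 |: S) zchar w j x + \sum_(x in T) zchar w j x = (n * (j == 0%R))%N%:R.
  transitivity (\sum_x zchar w j x).
    rewrite [RHS](bigID (mem (0 |: S))) /=; congr (_ + _).
    by apply: eq_bigl => x; rewrite inE.
  under eq_bigr do rewrite zcharC.
  by rewrite (sum_zchar w_prim); case: (j == 0); rewrite ?muln1 ?muln0 // mulr1n qE.
rewrite big_setU1 //= zchar0 sum_zchar_connection => /(canRL (addKr _)) ->.
by rewrite /mu rmorphB rmorphD rmorph1 rmorph_nat [LHS]addrC.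
Qed.

Let xi (j : 'Z_n) : R[i] := cis (2 * pi * ((1 + lam j) / p%:R)).
Let theta (b : bool) : R[i] := cis (2 * pi * ((1 + (2 * m.+1)%:R * (-1) ^+ b) / p%:R)).

Let p_neq0 : p%:R != 0 :> R.
Proof. by rewrite pnatr_eq0 -lt0n prime_gt0. Qed.

(** Comparing arguments, the relation makes the sum of (u_j - v_j)(1 + lam_j) equal to p z with z an
    integer. By [zchar_relation_dvd] the two arguments on the theta side then differ by a whole
    number of turns. *)
Let xi_theta (u v : 'Z_n -> nat) :
  \prod_j xi j ^+ u j = \prod_j xi j ^+ v j ->
  \prod_(j : 'Z_n) theta (odd j) ^+ u j = \prod_(j : 'Z_n) theta (odd j) ^+ v j.
Proof.
have prodE (f : 'Z_n -> R) (l : 'Z_n -> nat) :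
    \prod_j cis (2 * pi * (f j / p%:R)) ^+ l j =
      cis (2 * pi * ((\sum_j (l j)%:R * f j) / p%:R)).
  under eq_bigr do rewrite cisX.
  rewrite cis_prod mulr_suml mulr_sumr; congr cis; apply: eq_bigr => j _; ring.
have cis_eq (x y : R) : cis (2 * pi * x) = cis (2 * pi * y) <-> cis (2 * pi * (x - y)) = 1 :> R[i].
  split=> [xy|xy1].
    rewrite mulrBr cisD xy -cisD subrr; exact: cis0.
  by rewrite -[x](subrK y) mulrDr cisD xy1 mul1r.
rewrite !prodE => /cis_eq; rewrite -mulrBl -sumrB => /cis_2pi_eq1[z].
move=> /(canRL (divfK p_neq0)) rel.
have /dvdzP[y yE] : (p %| \sum_j (Posz (u j) - Posz (v j)) *
    (1 + (2 * m.+1)%:Z * (-1) ^+ (j : 'Z_n)))%Z.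
  apply: (zchar_relation_dvd (r := z) w_prim).
  have -> : (p%:Z * z)%:~R = (z%:~R * p%:R)%:C :> R[i].
    by rewrite intrM rmorphM /= rmorph_int rmorph_nat mulrC.
  rewrite -rel rmorph_sum; apply: eq_bigr => j _ /=.
  rewrite sum_zchar_connection -mulrBl [RHS]rmorphM /=; congr (_ * _).
    by rewrite [RHS]rmorphB !rmorph_nat intrB.
  by rewrite [RHS]rmorphD rmorph1.
apply/cis_eq; rewrite -mulrBl -sumrB.
have -> : \sum_(j : 'Z_n) ((u j)%:R * (1 + (2 * m.+1)%:R * (-1) ^+ odd j)
    - (v j)%:R * (1 + (2 * m.+1)%:R * (-1) ^+ odd j)) = (y * p%:Z)%:~R :> R.
  rewrite -yE rmorph_sum; apply: eq_bigr => j _ /=.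
  by rewrite -mulrBl intrM intrB intrD intrM rmorphXn rmorphN1 signr_odd.
by rewrite intrM mulfK // cis_2pi_int.
Qed.

Let theta_neq : coprime p m.+1 -> theta false != theta true.
Proof.
move=> p_co; apply/eqP => th.
(* The numerators for even and odd j differ by 4(m + 1), so equal values would make 4(m + 1) / p an
   integer. *)
have [z zE] : exists z : int, (4 * m.+1)%:R / p%:R = z%:~R :> R.
  apply: cis_2pi_eq1.
  have -> : 2 * pi * ((4 * m.+1)%:R / p%:R) =
      2 * pi * ((1 + (2 * m.+1)%:R * (-1) ^+ false) / p%:R)
      - 2 * pi * ((1 + (2 * m.+1)%:R * (-1) ^+ true) / p%:R) :> R.
    by rewrite !natrM /= expr0 expr1; ring.
  by rewrite cisD -/(theta false) th -cisD subrr cis0.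
have : (4 * m.+1)%N%:Z = z * p%:Z by apply: (@intr_inj R); rewrite intrM -zE divfK.
move=> /(congr1 absz); rewrite abszM /= => /esym pz.
have : (p %| 4 * m.+1)%N by rewrite -pz dvdn_mull.
rewrite Gauss_dvdl // (@Euclid_dvdX 2 2 p) //.
by rewrite dvdn_prime2 // => /andP[/eqP p2 _]; move: p_odd; rewrite p2.
Qed.

Let xi_transition (t : nat) :
  transition_mx (complement (circulant S)) (2 * pi * (t%:R / p%:R)) =
    \sum_j xi j ^+ t *: eigenproj w j.
Proof.
have -> : transition_mx (complement (circulant S)) (2 * pi * (t%:R / p%:R)) =
    transition_mx (circulant T) (2 * pi * (t%:R / p%:R)) :> 'M[R[i]]__.
  congr (expmx (_ *: _)); apply/matrixP => x y.
  by rewrite !mxE complement_circulant.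
rewrite (transition_circulant w_prim _ T0 sum_zchar_complement).
apply: eq_bigr => j _; congr (_ *: _).
rewrite /xi cisX.
have s_gt0 : (0 < s)%N by apply: leq_trans (k_lt ord0).
(* The term n [j = 0] of [mu j] only adds t n / p = 2 t p^(s-1) full turns, an integer because s >
   0. *)
have -> : - (2 * pi * (t%:R / p%:R) * mu j) = t%:R * (2 * pi * ((1 + lam j) / p%:R))
   + 2 * pi * (- (t * 2 * p ^ s.-1 * (j == 0%R))%N%:Z)%:~R.
  have nR : n%:R = 2 * (p%:R * (p ^ s.-1)%:R) :> R.
    by rewrite nE -[in LHS](prednK s_gt0) expnS !natrM.
  rewrite /mu mulrNz -pmulrn !natrM nR.
  by field.
by rewrite cisD cis_2pi_int mulr1.
Qed.

Let h : 'Z_n := (p ^ s)%N%:R.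

Let val_h : h = (p ^ s)%N :> nat.
Proof.
have ps_gt0 : (0 < p ^ s)%N by rewrite expn_gt0 prime_gt0.
by rewrite val_Zp_nat // modn_small // nE; lia.
Qed.

Let zchar_half (j : 'Z_n) : zchar w j h = (-1) ^+ odd j.
Proof. by rewrite /zchar val_h mulnC exprM (prim_expr_half w_prim) signr_odd. Qed.

(** The columns 0 and h of the projection differ by the sign (-1)^j. Hence weights al + be (-1)^j on
    the projections send e_0 to al e_0 + be e_h. *)
Let eigenproj_half (j : 'Z_n) :
  eigenproj w j *m delta_mx h 0 =
    (-1) ^+ odd j *: (eigenproj w j *m delta_mx 0 0 : 'cV_(Zp_trunc n).+2).
Proof.
rewrite -!colE; apply/matrixP => x y; rewrite !mxE subr0 (zcharD w_prim) (zcharN w_prim).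
by rewrite zchar_half invr_sign; ring.
Qed.

Lemma pgfr_complement_circulant : coprime p m.+1 -> pgfr R (complement (circulant S)).
Proof.
move=> p_co.
have h0 : 0 != h.
  apply/eqP => /(congr1 val) /=; rewrite val_h => /esym/eqP.
  by rewrite -leqn0 leqNgt expn_gt0 prime_gt0.
exists 0, h; split=> //.
have approx (r : nat) : exists t, forall j : 'Z_n, `|xi j ^+ t - theta (odd j)| < r.+1%:R^-1.
  apply: kronecker_approximation => //.
  - exact: complex_archimedean.
  - by move=> j; rewrite norm_cis.
  - by move=> j; rewrite norm_cis.
have {approx} [t tP] := choice approx.
(* These solve theta b = al + be (-1)^b for both parities; the parallelogram law then gives |al|^2 +
   |be|^2 = 1. *)
pose al : R[i] := (theta false + theta true) / 2.
pose be : R[i] := (theta false - theta true) / 2.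
have thetaE b : theta b = al + be * (-1) ^+ b.
  by rewrite /al /be; case: b; rewrite ?expr0 ?expr1; field.
exists (fun r => 2 * pi * ((t r)%:R / p%:R)), al, be; split.
- by rewrite mulf_neq0 ?invr_neq0 ?pnatr_eq0 // subr_eq0 theta_neq.
- have norm1 b : theta b * (theta b)^*%R = 1 by rewrite -normCK norm_cis expr1n.
  rewrite !normCK /al /be !rmorphM !fmorphV !rmorph_nat rmorphD rmorphB /=.
  transitivity ((theta false * (theta false)^*%R + theta true * (theta true)^*%R) / 2 : R[i]).
    by field.
  by rewrite !norm1 divff // pnatr_eq0.
have xi_cvg j : (fun r => xi j ^+ t r : R[i] : numFieldType) @ \oo -->
    (theta (odd j) : R[i] : numFieldType).
  apply/cvgrPdist_lt => e e0.
  have [N] := complex_archimedean e^-1; rewrite ger0_norm ?invr_ge0 ?ltW // => eN.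
  exists N => // r /= Nr; rewrite distrC; apply: lt_trans (tP r j) _.
  rewrite -[ltRHS]invrK ltf_pV2 ?posrE ?invr_gt0 //.
  by apply: lt_le_trans eN _; rewrite ler_nat leqW.
have -> : al *: delta_mx 0 0 + be *: delta_mx h 0 =
    \sum_j theta (odd (j : 'Z_n)) *: (eigenproj w j *m delta_mx 0 0)
    :> 'cV[R[i]]_(Zp_trunc n).+2.
  rewrite -[delta_mx 0 0 in LHS]mul1mx -[delta_mx h 0]mul1mx -(sum_eigenproj w_prim).
  rewrite !mulmx_suml !scaler_sumr -big_split /=; apply: eq_bigr => j _.
  by rewrite eigenproj_half scalerA -scalerDl -thetaE.
have -> : (fun r => transition_mx (complement (circulant S)) (2 * pi * ((t r)%:R / p%:R))
                      *m delta_mx 0 0) =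
    (fun r => \sum_j xi j ^+ t r *: (eigenproj w j *m delta_mx 0 0))
    :> (nat -> 'cV[R[i]]_(Zp_trunc n).+2).
  apply/funext => r; rewrite xi_transition mulmx_suml; apply: eq_bigr => j _.
  by rewrite scalemxAl.
have := cvg_linear_combination (V := 'M[R[i] : numFieldType]_((Zp_trunc n).+2, 1))
  (v := fun j => eigenproj w j *m delta_mx 0 0) xi_cvg.
exact.
Qed.

End Revival.

End Connection.

Unset Implicit Arguments.

Theorem theorem4p3 (R : realType) (p s n : nat)
    (hp : prime p) (hodd : odd p) (hs : (0 < s)%N)
    (hn : n = (2 * p ^ s)%N)
    (m : nat) (k : 'I_m.+1 -> nat)
    (hk0 : k ord0 = 0%N)
    (hkinc : forall i j : 'I_m.+1, (i < j)%N -> (k i < k j)%N)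
    (hks : (k ord_max < s)%N)
    (S : {set 'Z_n})
    (hS : S = [set (p ^ k i)%:R | i : 'I_m.+1]
              :|: [set (n - p ^ k i)%N%:R | i : 'I_m.+1])
    (hgcd : gcdn p m.+1 = 1%N) :
  pgfr R (complement (circulant S)).
Proof.
rewrite hS; apply: (pgfr_complement_circulant (s := s)) => //.
by rewrite /coprime hgcd.
Qed.
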